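(* Let $\mathcal{A}$ be a vector space over the field $\mathcal{K}$, let $\Delta:\mathcal{A}\to\mathcal{A}\otimes\mathcal{A}\otimes\mathcal{A}$ be a linear map, and let $\Delta^{*}:\mathcal{A}^{*}\otimes\mathcal{A}^{*}\otimes\mathcal{A}^{*}\to\mathcal{A}^{*}$ be its dual map. Then: (1) $(\mathcal{A},\Delta)$ is a partially coassociative $3$-ary coalgebra if and only if $(\mathcal{A}^{*},\Delta^{*})$ is a partially associative $3$-ary algebra. (2) $(\mathcal{A},\Delta)$ is a totally coassociative $3$-ary coalgebra if and only if $(\mathcal{A}^{*},\Delta^{*})$ is a totally associative $3$-ary algebra. (3) $(\mathcal{A},\Delta)$ is a weak totally coassociative $3$-ary coalgebra if and only if $(\mathcal{A}^{*},\Delta^{*})$ is a weak totally associative $3$-ary algebra.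
   Context: $\mathcal{K}$ is a fixed field of characteristic zero; $\mathcal{A}^*$ is the dual space of $\mathcal{A}$ and $\langle\xi,x\rangle=\xi(x)$. The dual map $\Delta^*$ is defined by $\langle\Delta^{*}(\xi,\eta,\gamma),x\rangle=\langle\xi\otimes\eta\otimes\gamma,\Delta(x)\rangle$ for $\xi,\eta,\gamma\in\mathcal{A}^*$, $x\in\mathcal{A}$, where $\langle\xi\otimes\eta\otimes\gamma,x\otimes y\otimes z\rangle=\langle\xi,x\rangle\langle\eta,y\rangle\langle\gamma,z\rangle$. A vector space $V$ with a trilinear operation $\mu:V\otimes V\otimes V\to V$ is: a partially associative $3$-ary algebra if $\mu\circ(\mu\otimes\mathrm{id}\otimes\mathrm{id}+\mathrm{id}\otimes\mu\otimes\mathrm{id}+\mathrm{id}\otimes\mathrm{id}\otimes\mu)=0$; a totally associative $3$-ary algebra if $\mu\circ(\mu\otimes\mathrm{id}\otimes\mathrm{id})=\mu\circ(\mathrm{id}\otimes\mu\otimes\mathrm{id})=\mu\circ(\mathrm{id}\otimes\mathrm{id}\otimes\mu)$; a weak totally associative $3$-ary algebra if $\mu\circ(\mu\otimes\mathrm{id}\otimes\mathrm{id})=\mu\circ(\mathrm{id}\otimes\mathrm{id}\otimes\mu)$. A vector space $V$ with a linear map $\Delta:V\to V\otimes V\otimes V$ is: a partially coassociative $3$-ary coalgebra if $(\Delta\otimes\mathrm{id}\otimes\mathrm{id}+\mathrm{id}\otimes\Delta\otimes\mathrm{id}+\mathrm{id}\otimes\mathrm{id}\otimes\Delta)\circ\Delta=0$;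 a totally coassociative $3$-ary coalgebra if $(\Delta\otimes\mathrm{id}\otimes\mathrm{id})\circ\Delta=(\mathrm{id}\otimes\Delta\otimes\mathrm{id})\circ\Delta=(\mathrm{id}\otimes\mathrm{id}\otimes\Delta)\circ\Delta$; a weak totally coassociative $3$-ary coalgebra if $(\Delta\otimes\mathrm{id}\otimes\mathrm{id})\circ\Delta=(\mathrm{id}\otimes\mathrm{id}\otimes\Delta)\circ\Delta$. *)

(* Defs.v *)
From HB Require Import structures.
From mathcomp Require Import all_boot all_algebra.
From mathcomp Require Import boolp.
From mathcomp.multinomials Require Import freeg.

Set Implicit Arguments.
Unset Strict Implicit.
Unset Printing Implicit Defensive.

Import GRing.Theory.

Local Open Scope ring_scope.
Local Open Scope quotient_scope.

Lemma linear_eqP (K : comNzRingType) (U V : lmodType K)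
    (f g : {linear U -> V}) : f =1 g -> f = g.
Proof.
case: f => f [[f1] [f2]]; case: g => g [[g1] [g2]] /= /funext fg.
by subst g; rewrite (Prop_irrelevance f1 g1) (Prop_irrelevance f2 g2).
Qed.

Section Hom.
Variables (K : comNzRingType) (U V : lmodType K).
Implicit Types f g h : {linear U -> V}.

HB.instance Definition _ := gen_eqMixin {linear U -> V}.
HB.instance Definition _ := gen_choiceMixin {linear U -> V}.

Definition hom0 : {linear U -> V} := \0.
Definition homN f : {linear U -> V} := \- f.
Definition homD f g : {linear U -> V} := f \+ g.
Definition homZ (a : K) f : {linear U -> V} := a \*: f.

Fact homDA : associative homD.
Proof. by move=> f g h; apply/linear_eqP => x /=; rewrite addrA. Qed.
Fact homDC : commutative homD.
Proof. by move=> f g; apply/linear_eqP => x /=; rewrite addrC. Qed.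
Fact hom0D : left_id hom0 homD.
Proof. by move=> f; apply/linear_eqP => x /=; rewrite add0r. Qed.
Fact homND : left_inverse hom0 homN homD.
Proof. by move=> f; apply/linear_eqP => x /=; rewrite addNr. Qed.

HB.instance Definition _ :=
  GRing.isZmodule.Build {linear U -> V} homDA homDC hom0D homND.

Fact homZA a b f : homZ a (homZ b f) = homZ (a * b) f.
Proof. by apply/linear_eqP => x /=; rewrite scalerA. Qed.
Fact hom1Z : left_id 1 homZ.
Proof. by move=> f; apply/linear_eqP => x /=; rewrite scale1r. Qed.
Fact homZDr : right_distributive homZ +%R.
Proof. by move=> a f g; apply/linear_eqP => x /=; rewrite scalerDr. Qed.
Fact homZDl f : {morph homZ^~ f : a b / a + b}.
Proof. by move=> a b; apply/linear_eqP => x /=; rewrite scalerDl. Qed.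

HB.instance Definition _ := GRing.Zmodule_isLmodule.Build K {linear U -> V}
  homZA hom1Z homZDr homZDl.

Lemma linearDE f g x : (f + g) x = f x + g x. Proof. by []. Qed.
Lemma linearNE f x : (- f) x = - f x. Proof. by []. Qed.
Lemma linear0E x : (0 : {linear U -> V}) x = 0. Proof. by []. Qed.
Lemma linearZE a f x : (a *: f) x = a *: f x. Proof. by []. Qed.

End Hom.

Section QuotientModule.
Variables (K : pzRingType) (V : lmodType K) (S : V -> bool).
Hypothesis S_submod : submod_closed S.

Let S_zmod := GRing.isZmodClosed.Build V S (GRing.submod_closedB S_submod).

Definition quot_zmodClosed : zmodClosed V := HB.pack S S_zmod.

Definition quot_mod : Type := Quotient.quot quot_zmodClosed.
HB.instance Definition _ := GRing.Zmodule.on quot_mod.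
HB.instance Definition _ := Quotient.on quot_mod.

Definition quot_scale (a : K) (t : quot_mod) : quot_mod := \pi_quot_mod (a *: repr t).

Lemma pi_add x y : \pi_quot_mod (x + y) = \pi x + \pi y.
Proof. exact: (raddfD (\pi_(Quotient.quot quot_zmodClosed))). Qed.

Lemma pi_eq x y : \pi_quot_mod x = \pi y <-> S (x - y).
Proof.
by rewrite -[S _]/(x - y \in quot_zmodClosed) Quotient.idealrBE; split=> /eqP.
Qed.

Lemma pi_scale a x : \pi_quot_mod (a *: x) = quot_scale a (\pi x).
Proof.
apply/pi_eq; rewrite -scalerBr -[_ *: _]addr0.
have [S0 SP] := S_submod; apply: (SP a _ _ _ S0); rewrite unfold_in.
by apply/pi_eq; rewrite reprK.
Qed.

Fact quot_scaleA a b t : quot_scale a (quot_scale b t) = quot_scale (a * b) t.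
Proof. by rewrite -[t]reprK -(pi_scale b) -(pi_scale a) scalerA pi_scale. Qed.
Fact quot_scale1 : left_id 1 quot_scale.
Proof. by move=> t; rewrite -[t]reprK -(pi_scale 1) scale1r. Qed.
Fact quot_scaleDr : right_distributive quot_scale +%R.
Proof.
move=> a s t; rewrite -[s]reprK -[t]reprK -pi_add.
by rewrite -!(pi_scale a) scalerDr pi_add.
Qed.
Fact quot_scaleDl t : {morph quot_scale^~ t : a b / a + b}.
Proof.
move=> a b; rewrite -[t]reprK -(pi_scale a) -(pi_scale b).
by rewrite -(pi_scale (a + b)) scalerDl pi_add.
Qed.
HB.instance Definition _ := GRing.Zmodule_isLmodule.Build K quot_mod
  quot_scaleA quot_scale1 quot_scaleDr quot_scaleDl.

Definition quot_pi (x : V) : quot_mod := \pi_quot_mod x.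

Fact quot_pi_linear : linear quot_pi.
Proof. by move=> a x y; rewrite /quot_pi pi_add pi_scale. Qed.
HB.instance Definition _ := GRing.isLinear.Build K V quot_mod *:%R quot_pi
  quot_pi_linear.

Lemma quot_piP x y : quot_pi x = quot_pi y <-> S (x - y).
Proof. exact: pi_eq. Qed.

Lemma quot_piK (t : quot_mod) : quot_pi (repr t) = t. Proof. exact: reprK. Qed.

End QuotientModule.

Section LiftFree.
Variables (K : nzRingType) (T : choiceType) (W : lmodType K) (f : T -> W).

Fact fglift_linear : linear (fglift f : {freeg T / K} -> W).
Proof.
have zm : zmod_morphism (fglift f : {freeg T / K} -> W).
  exact: lift_is_additive.
pose g : {additive {freeg T / K} -> W} :=
  HB.pack (fglift f : {freeg T / K} -> W)
    (GRing.isZmodMorphism.Build {freeg T / K} W (fglift f) zm).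
move=> a x y; rewrite -[fglift f _]/(g _) raddfD /=; congr (_ + _).
rewrite -[in RHS](freeg_sumE x) -[fglift f (a *: x)]/(g (fgscale a x)).
rewrite /fgscale -[RHS]/(a *: g _) !raddf_sum /=.
by apply: eq_bigr => z _; rewrite !liftU scalerA.
Qed.

End LiftFree.

(* The tensor product is the quotient of the free module on the pairs by the
   submodule that the bilinearity relations generate. *)
Section Tensor.
Variables (K : comNzRingType) (U V : lmodType K).

Definition free_pairs : lmodType K := {freeg (U * V) / K}.
Definition free_pair (u : U) (v : V) : free_pairs := << (u, v) >>.

Inductive tensor_rel : free_pairs -> Prop :=
| tensor_rel0 : tensor_rel 0
| tensor_relP a x y : tensor_rel x -> tensor_rel y -> tensor_rel (a *: x + y)
| tensor_relDl u u' v :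
    tensor_rel (free_pair (u + u') v - (free_pair u v + free_pair u' v))
| tensor_relDr u v v' :
    tensor_rel (free_pair u (v + v') - (free_pair u v + free_pair u v'))
| tensor_relZl a u v : tensor_rel (free_pair (a *: u) v - a *: free_pair u v)
| tensor_relZr a u v : tensor_rel (free_pair u (a *: v) - a *: free_pair u v).

Definition tensor_relb (x : free_pairs) : bool := `[< tensor_rel x >].

Fact tensor_rel_submod_closed : submod_closed tensor_relb.
Proof.
split; first exact/asboolP/tensor_rel0.
move=> a x y /asboolP Rx /asboolP Ry; apply/asboolP.
exact: tensor_relP.
Qed.
Definition tensor : lmodType K := quot_mod tensor_rel_submod_closed.

Definition tens_pi : {linear free_pairs -> tensor} := @quot_pi _ _ _ _.

Lemma tens_piP x y : tens_pi x = tens_pi y <-> tensor_rel (x - y).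
Proof.
by split=> [/quot_piP /asboolP|Rxy] //; apply/quot_piP/asboolP.
Qed.

Definition tens (u : U) (v : V) : tensor := tens_pi (free_pair u v).

Lemma tensDl u u' v : tens (u + u') v = tens u v + tens u' v.
Proof. by rewrite -linearD; apply/tens_piP/tensor_relDl. Qed.
Lemma tensDr u v v' : tens u (v + v') = tens u v + tens u v'.
Proof. by rewrite -linearD; apply/tens_piP/tensor_relDr. Qed.
Lemma tensZl a u v : tens (a *: u) v = a *: tens u v.
Proof. by rewrite -linearZ; apply/tens_piP/tensor_relZl. Qed.
Lemma tensZr a u v : tens u (a *: v) = a *: tens u v.
Proof. by rewrite -linearZ; apply/tens_piP/tensor_relZr. Qed.

Fact tens_zmodl v : zmod_morphism (tens^~ v).
Proof. by move=> u u'; rewrite tensDl -scaleN1r tensZl scaleN1r. Qed.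
Fact tens_zmodr u : zmod_morphism (tens u).
Proof. by move=> v v'; rewrite tensDr -scaleN1r tensZr scaleN1r. Qed.
HB.instance Definition _ := @isBilinear.Build K U V tensor *:%R *:%R tens
  tens_zmodl tens_zmodr (fun v a u => tensZl a u v) (fun u a => tensZr a u).

Section Lift.
Variables (W : lmodType K) (f : {bilinear U -> V -> W}).

Definition free_lift (x : free_pairs) : W := fglift (fun p => f p.1 p.2) x.

Fact free_lift_linear : linear free_lift. Proof. exact: fglift_linear. Qed.
HB.instance Definition _ := GRing.isLinear.Build K free_pairs W *:%R free_lift
  free_lift_linear.

Lemma free_liftE u v : free_lift (free_pair u v) = f u v.
Proof. by rewrite /free_lift liftU scale1r. Qed.

Lemma free_lift_rel x : tensor_rel x -> free_lift x = 0.
Proof.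
elim=> [|a y z _ y0 _ z0|u u' v|u v v'|a u v|a u v].
- exact: linear0.
- by rewrite linearP /= y0 z0 scaler0 addr0.
- by rewrite linearB linearD /= !free_liftE linearDl subrr.
- by rewrite linearB linearD /= !free_liftE linearDr subrr.
- by rewrite linearB linearZ /= !free_liftE linearZl_LR subrr.
- by rewrite linearB linearZ /= !free_liftE linearZr subrr.
Qed.

Definition tensor_lift_fun (t : tensor) : W := free_lift (repr t).

Lemma tensor_lift_pi x : tensor_lift_fun (tens_pi x) = free_lift x.
Proof.
apply: subr0_eq; rewrite -linearB; apply: free_lift_rel; apply/tens_piP.
exact: quot_piK.
Qed.

Fact tensor_lift_linear : linear tensor_lift_fun.
Proof.
move=> a s t; rewrite -[s]quot_piK -[t]quot_piK -!/(tens_pi _).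
by rewrite -linearP !tensor_lift_pi linearP.
Qed.
HB.instance Definition _ := GRing.isLinear.Build K tensor W *:%R tensor_lift_fun
  tensor_lift_linear.

Definition tensor_lift : {linear tensor -> W} := tensor_lift_fun.

Lemma tensor_liftE u v : tensor_lift (tens u v) = f u v.
Proof. by rewrite -free_liftE -tensor_lift_pi. Qed.

End Lift.

Lemma tensor_ind (P : tensor -> Prop) :
    P 0 -> (forall s t, P s -> P t -> P (s + t)) -> (forall u v, P (tens u v)) ->
  forall t, P t.
Proof.
move=> P0 PD Pt t; rewrite -[t]quot_piK -[quot_pi _ _]/(tens_pi _).
rewrite -(freeg_sumE (repr t)) linear_sum; apply: big_ind => // -[u v] _.
set c := coeff _ _.
have -> : << c *g (u, v) >> = c *: free_pair u v :> free_pairs.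
  by apply/eqP/freeg_eqP => z; rewrite coeffZ !coeffU mul1r.
by rewrite linearZ_LR -[tens_pi _]/(tens u v) -tensZl.
Qed.

Lemma tensor_linear_eq (W : lmodType K) (f g : {linear tensor -> W}) :
  (forall u v, f (tens u v) = g (tens u v)) -> f =1 g.
Proof.
move=> fg; elim/tensor_ind => [|s t fs ft|//]; first by rewrite !linear0.
by rewrite !linearD fs ft.
Qed.

End Tensor.

Notation "U ⊗ V" := (tensor U V) (at level 40, left associativity).
Notation "u ⊗t v" := (tens u v) (at level 40, left associativity) : ring_scope.

Section TensorMap.
Variables (K : comNzRingType) (U U' V V' : lmodType K).
Variables (f : {linear U -> U'}) (g : {linear V -> V'}).

Definition tens_map (u : U) (v : V) : U' ⊗ V' := f u ⊗t g v.

Fact tens_map_zmodl v : zmod_morphism (tens_map^~ v).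
Proof. by move=> u u'; rewrite /tens_map linearB linearBl. Qed.
Fact tens_map_zmodr u : zmod_morphism (tens_map u).
Proof. by move=> v v'; rewrite /tens_map linearB linearBr. Qed.
Fact tens_map_scalel v : scalable (tens_map^~ v).
Proof. by move=> a u; rewrite /tens_map linearZ_LR tensZl. Qed.
Fact tens_map_scaler u : scalable (tens_map u).
Proof. by move=> a v; rewrite /tens_map linearZ_LR tensZr. Qed.
HB.instance Definition _ := @isBilinear.Build K U V (U' ⊗ V') *:%R *:%R
  tens_map tens_map_zmodl tens_map_zmodr tens_map_scalel tens_map_scaler.

Definition tensor_map : {linear U ⊗ V -> U' ⊗ V'} := tensor_lift tens_map.

Lemma tensor_mapE u v : tensor_map (u ⊗t v) = f u ⊗t g v.
Proof. exact: tensor_liftE. Qed.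

End TensorMap.

Notation "f ⊗m g" := (tensor_map f g)
  (at level 40, left associativity) : ring_scope.

Section TensorMapTheory.
Variables (K : comNzRingType) (U U' V V' : lmodType K).

Lemma tensor_mapPl a (f f' : {linear U -> U'}) (g : {linear V -> V'}) :
  (a *: f + f') ⊗m g = a *: (f ⊗m g) + f' ⊗m g.
Proof.
apply/linear_eqP/tensor_linear_eq => u v.
by rewrite !linearDE !linearZE !tensor_mapE linearDE linearZE tensDl tensZl.
Qed.

Lemma tensor_mapPr a (f : {linear U -> U'}) (g g' : {linear V -> V'}) :
  f ⊗m (a *: g + g') = a *: (f ⊗m g) + f ⊗m g'.
Proof.
apply/linear_eqP/tensor_linear_eq => u v.
by rewrite !linearDE !linearZE !tensor_mapE linearDE linearZE tensDr tensZr.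
Qed.

End TensorMapTheory.

Section Slices.
Variables (K : comNzRingType) (U V : lmodType K).

Definition tens_at (u : U) : V -> U ⊗ V := tens u.
Fact tens_at_linear u : linear (tens_at u).
Proof. by move=> a v v'; rewrite /tens_at tensDr tensZr. Qed.
HB.instance Definition _ u :=
  GRing.isLinear.Build K V (U ⊗ V) *:%R (tens_at u) (tens_at_linear u).

Definition tens_by (v : V) : U -> U ⊗ V := fun u => tens u v.
Fact tens_by_linear v : linear (tens_by v).
Proof. by move=> a u u'; rewrite /tens_by tensDl tensZl. Qed.
HB.instance Definition _ v :=
  GRing.isLinear.Build K U (U ⊗ V) *:%R (tens_by v) (tens_by_linear v).

Lemma tens_atP a u u' : tens_at (a *: u + u') =
  a *: (tens_at u : {linear V -> U ⊗ V}) + (tens_at u' : {linear V -> U ⊗ V})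
  :> {linear V -> U ⊗ V}.
Proof. by apply/linear_eqP => v; rewrite /= /tens_at tensDl tensZl. Qed.

Lemma tens_byP a v v' : tens_by (a *: v + v') =
  a *: (tens_by v : {linear U -> U ⊗ V}) + (tens_by v' : {linear U -> U ⊗ V})
  :> {linear U -> U ⊗ V}.
Proof. by apply/linear_eqP => u; rewrite /= /tens_by tensDr tensZr. Qed.

End Slices.

Section Associator.
Variables (K : comNzRingType) (U V W : lmodType K).

Definition tensA_fun (t : U ⊗ V) (w : W) : U ⊗ (V ⊗ W) :=
  (idfun ⊗m tens_by w) t.

Fact tensA_bilinear : bilinear_for
  (GRing.Scale.Law.clone _ _ *:%R _) (GRing.Scale.Law.clone _ _ *:%R _)
  tensA_fun.
Proof.
split=> [w|t] a x y; rewrite /tensA_fun; first by rewrite linearP.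
by rewrite tens_byP tensor_mapPr.
Qed.
HB.instance Definition _ := bilinear_isBilinear.Build K (U ⊗ V) W (U ⊗ (V ⊗ W))
  _ _ tensA_fun tensA_bilinear.

Definition tensorA : {linear (U ⊗ V) ⊗ W -> U ⊗ (V ⊗ W)} :=
  tensor_lift tensA_fun.

Lemma tensorAE u v w : tensorA ((u ⊗t v) ⊗t w) = u ⊗t (v ⊗t w).
Proof. by rewrite /tensorA tensor_liftE /= /tensA_fun tensor_mapE. Qed.

Definition tensAV_fun (u : U) (t : V ⊗ W) : (U ⊗ V) ⊗ W :=
  (tens_at u ⊗m idfun) t.

Fact tensAV_bilinear : bilinear_for
  (GRing.Scale.Law.clone _ _ *:%R _) (GRing.Scale.Law.clone _ _ *:%R _)
  tensAV_fun.
Proof.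
split=> [t|u] a x y; rewrite /tensAV_fun; last by rewrite linearP.
by rewrite tens_atP tensor_mapPl.
Qed.
HB.instance Definition _ := bilinear_isBilinear.Build K U (V ⊗ W) ((U ⊗ V) ⊗ W)
  _ _ tensAV_fun tensAV_bilinear.

Definition tensorAV : {linear U ⊗ (V ⊗ W) -> (U ⊗ V) ⊗ W} :=
  tensor_lift tensAV_fun.

Lemma tensorAVE u v w : tensorAV (u ⊗t (v ⊗t w)) = (u ⊗t v) ⊗t w.
Proof. by rewrite /tensorAV tensor_liftE /= /tensAV_fun tensor_mapE. Qed.

End Associator.

Section TernaryOperations.
Variables (K : comNzRingType) (V : lmodType K).

Local Notation V3 := (V ⊗ V ⊗ V).
Local Notation V5 := (V ⊗ V ⊗ V ⊗ V ⊗ V).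

(* The canonical identifications of the iterated tensor products of five
   factors; the left-nested one is taken as the fifth tensor power. *)
Definition split131 : {linear V5 -> V ⊗ V3 ⊗ V} :=
  (tensorA V (V ⊗ V) V \o (tensorA V V V ⊗m idfun)) ⊗m idfun.
Definition join131 : {linear V ⊗ V3 ⊗ V -> V5} :=
  ((tensorAV V V V ⊗m idfun) \o tensorAV V (V ⊗ V) V) ⊗m idfun.
Definition split113 : {linear V5 -> V ⊗ V ⊗ V3} :=
  tensorA (V ⊗ V) (V ⊗ V) V \o (tensorA (V ⊗ V) V V ⊗m idfun).
Definition join113 : {linear V ⊗ V ⊗ V3 -> V5} :=
  (tensorAV (V ⊗ V) V V ⊗m idfun) \o tensorAV (V ⊗ V) (V ⊗ V) V.

Lemma split131E a b c d e :
  split131 (a ⊗t b ⊗t c ⊗t d ⊗t e) = a ⊗t (b ⊗t c ⊗t d) ⊗t e.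
Proof. by rewrite tensor_mapE /= tensor_mapE !tensorAE. Qed.
Lemma join131E a b c d e :
  join131 (a ⊗t (b ⊗t c ⊗t d) ⊗t e) = a ⊗t b ⊗t c ⊗t d ⊗t e.
Proof. by rewrite tensor_mapE /= tensorAVE tensor_mapE !tensorAVE. Qed.
Lemma split113E a b c d e :
  split113 (a ⊗t b ⊗t c ⊗t d ⊗t e) = a ⊗t b ⊗t (c ⊗t d ⊗t e).
Proof. by rewrite /= tensor_mapE !tensorAE. Qed.
Lemma join113E a b c d e :
  join113 (a ⊗t b ⊗t (c ⊗t d ⊗t e)) = a ⊗t b ⊗t c ⊗t d ⊗t e.
Proof. by rewrite /= tensorAVE tensor_mapE !tensorAVE. Qed.

Section Algebra.
Variable mu : {linear V3 -> V}.

Definition mu_id_id : {linear V5 -> V3} := mu ⊗m idfun ⊗m idfun.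
Definition id_mu_id : {linear V5 -> V3} := (idfun ⊗m mu ⊗m idfun) \o split131.
Definition id_id_mu : {linear V5 -> V3} := (idfun ⊗m idfun ⊗m mu) \o split113.

Definition partially_associative : Prop :=
  mu \o (mu_id_id \+ id_mu_id \+ id_id_mu) =1 \0.

Definition totally_associative : Prop :=
  mu \o mu_id_id =1 mu \o id_mu_id /\ mu \o id_mu_id =1 mu \o id_id_mu.

Definition weak_totally_associative : Prop :=
  mu \o mu_id_id =1 mu \o id_id_mu.

End Algebra.

Section Coalgebra.
Variable Delta : {linear V -> V3}.

Definition Delta_id_id : {linear V3 -> V5} := Delta ⊗m idfun ⊗m idfun.
Definition id_Delta_id : {linear V3 -> V5} :=
  join131 \o (idfun ⊗m Delta ⊗m idfun).
Definition id_id_Delta : {linear V3 -> V5} :=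
  join113 \o (idfun ⊗m idfun ⊗m Delta).

Definition partially_coassociative : Prop :=
  (Delta_id_id \+ id_Delta_id \+ id_id_Delta) \o Delta =1 \0.

Definition totally_coassociative : Prop :=
  Delta_id_id \o Delta =1 id_Delta_id \o Delta
  /\ id_Delta_id \o Delta =1 id_id_Delta \o Delta.

Definition weak_totally_coassociative : Prop :=
  Delta_id_id \o Delta =1 id_id_Delta \o Delta.

End Coalgebra.

End TernaryOperations.

Definition dual_space (K : comNzRingType) (V : lmodType K) : lmodType K :=
  {linear V -> K^o}.

Definition pairing (K : comNzRingType) (V : lmodType K) (xi : dual_space V) (x : V)
  : K := (xi : {linear V -> K^o}) x.

Notation "⟨ xi , x ⟩" := (pairing xi x) (at level 0) : ring_scope.

Section DualTensor.
Variables (K : comNzRingType) (U V : lmodType K).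

Definition pairing_prod (xi : dual_space U) (eta : dual_space V) (u : U) (v : V)
  : K^o := ⟨xi, u⟩ * ⟨eta, v⟩.

Fact pairing_prod_bilinear xi eta : bilinear_for
  (GRing.Scale.Law.clone _ _ *:%R _) (GRing.Scale.Law.clone _ _ *:%R _)
  (pairing_prod xi eta).
Proof.
split=> [v|u] a x y; rewrite /pairing_prod /pairing linearP /=.
  by rewrite mulrDl; congr (_ + _); rewrite [RHS]mulrA.
by rewrite mulrDr; congr (_ + _); apply: mulrCA.
Qed.
HB.instance Definition _ xi eta := bilinear_isBilinear.Build K U V K^o
  _ _ (pairing_prod xi eta) (pairing_prod_bilinear xi eta).

Definition pairing_tens (xi : dual_space U) (eta : dual_space V)
  : dual_space (U ⊗ V) := tensor_lift (pairing_prod xi eta).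

Lemma pairing_tensE xi eta u v :
  ⟨pairing_tens xi eta, u ⊗t v⟩ = ⟨xi, u⟩ * ⟨eta, v⟩.
Proof. by rewrite /pairing /pairing_tens tensor_liftE. Qed.

Fact pairing_tens_bilinear : bilinear_for
  (GRing.Scale.Law.clone _ _ *:%R _) (GRing.Scale.Law.clone _ _ *:%R _)
  pairing_tens.
Proof.
split=> [eta|xi] a x y; apply/linear_eqP/tensor_linear_eq => u v.
  rewrite linearDE linearZE -!/(pairing _ _) !pairing_tensE.
  by rewrite /pairing linearDE linearZE mulrDl; congr (_ + _); rewrite [RHS]mulrA.
rewrite linearDE linearZE -!/(pairing _ _) !pairing_tensE.
by rewrite /pairing linearDE linearZE mulrDr; congr (_ + _); apply: mulrCA.
Qed.
HB.instance Definition _ := bilinear_isBilinear.Build K (dual_space U)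
  (dual_space V) (dual_space (U ⊗ V)) _ _ pairing_tens pairing_tens_bilinear.

(* An element of the tensor product of duals, seen as a functional. *)
Definition dual_tensor : {linear dual_space U ⊗ dual_space V ->
  dual_space (U ⊗ V)} := tensor_lift pairing_tens.

Lemma dual_tensorE xi eta u v :
  ⟨dual_tensor (xi ⊗t eta), u ⊗t v⟩ = ⟨xi, u⟩ * ⟨eta, v⟩.
Proof. by rewrite /dual_tensor tensor_liftE pairing_tensE. Qed.

End DualTensor.

Section DualMap.
Variables (K : comNzRingType) (A : lmodType K).

Local Notation A' := (dual_space A).

Definition dual_tensor3 : {linear A' ⊗ A' ⊗ A' -> dual_space (A ⊗ A ⊗ A)} :=
  dual_tensor (A ⊗ A) A \o (dual_tensor A A ⊗m idfun).

Lemma dual_tensor3E xi eta gamma x y z :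
  ⟨dual_tensor3 (xi ⊗t eta ⊗t gamma), x ⊗t y ⊗t z⟩
    = ⟨xi, x⟩ * ⟨eta, y⟩ * ⟨gamma, z⟩.
Proof. by rewrite /= tensor_mapE !dual_tensorE. Qed.

Variable Delta : {linear A -> A ⊗ A ⊗ A}.

Definition dual_map_fun (t : A' ⊗ A' ⊗ A') : A' :=
  (dual_tensor3 t : {linear _ -> K^o}) \o Delta.

Fact dual_map_linear : linear dual_map_fun.
Proof.
by move=> a s t; apply/linear_eqP => x; rewrite /dual_map_fun linearP.
Qed.
HB.instance Definition _ := GRing.isLinear.Build K (A' ⊗ A' ⊗ A') A' *:%R
  dual_map_fun dual_map_linear.

Definition dual_map : {linear A' ⊗ A' ⊗ A' -> A'} := dual_map_fun.

Lemma dual_mapE xi eta gamma x :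
  ⟨dual_map (xi ⊗t eta ⊗t gamma), x⟩
    = ⟨dual_tensor3 (xi ⊗t eta ⊗t gamma), Delta x⟩.
Proof. by []. Qed.

End DualMap.

(* Main.v *)
(* For t in the fifth tensor power of the dual of A, read as a functional on the
   fifth tensor power of A, the operation mu = Delta^* satisfies
     < mu (mu (x) id (x) id) t, x > = < t, (Delta (x) id (x) id) (Delta x) >,
   and likewise for the other two positions; so every identity between the
   composites of Delta yields the dual identity for mu.  Conversely, such t
   separate the points of the fifth tensor power: functionals separate the
   points of a vector space (Zorn), and this passes to tensor products by
   induction on the number of pure tensors in a sum, so no dimension hypothesis
   is needed. *)
Require Import Defs.
From HB Require Import structures.
From mathcomp Require Import all_boot all_algebra.
From mathcomp Require Import boolp classical_sets.

Set Implicit Arguments.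
Unset Strict Implicit.
Unset Printing Implicit Defensive.

Import GRing.Theory.
Local Open Scope ring_scope.

(** * Linear functionals separate points *)

Lemma dual_space_separates (K : fieldType) (V : lmodType K) (a : V) :
  a != 0 -> exists xi : dual_space V, ⟨xi, a⟩ != 0.
Proof.
move=> a0.
pose P (X : set V) := ~ X a /\ forall c x y, X x -> X y -> X (c *: x + y).
(* [M] is a maximal subspace avoiding [a], hence a hyperplane complementary to
   the line of [a]; [xi] is the coordinate along [a]. *)
have [F FP Ftot|M [[Ma Mlin] Mmax]] := @Zorn_bigcup V P.
  split=> [[X /FP[]]//|c x y [X FX Xx] [Y FY Yy]].
  have [/(_ _ Xx) Yx|/(_ _ Yy) Xy] := Ftot X Y FX FY.
    by exists Y => //; apply: (FP Y FY).2.
  by exists X => //; apply: (FP X FX).2.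
(* [P] admits the empty set, the union of the empty chain. If [M] missed 0 it would be empty, hence
   strictly inside {0}, which also satisfies [P]. *)
have M0 : M 0.
  apply: contrapT => nM0; have M_empty x : ~ M x.
    by move=> Mx; apply: nM0; rewrite -[0](addNr x) -scaleN1r; apply: Mlin.
  apply: (Mmax (fun x => x = 0)); first by split=> [x /M_empty//|/(_ _ erefl)].
  split=> [/eqP|c _ _ -> ->]; first by rewrite (negPf a0).
  by rewrite scaler0 addr0.
have MZ c x : M x -> M (c *: x) by move=> Mx; rewrite -[_ *: _]addr0; apply: Mlin.
have ex_coord x : exists c, M (x - c *: a).
  apply: contrapT => no_c.
  have Mx : ~ M x by move=> Mx; apply: no_c; exists 0; rewrite scale0r subr0.
  (* This set is [M] plus the line of [x]. If it contained [a], with [a - c *: x] in [M], then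
     [c != 0] and [x - c^-1 *: a] would lie in [M]. *)
  apply: (Mmax (fun z => exists2 c, M (z - c *: x) & True)).
    split=> [z Mz|sub]; first by exists 0; rewrite // scale0r subr0.
    by apply/Mx/sub; exists 1; rewrite // scale1r subrr.
  split=> [[c Mc _]|c y z [d My _] [e Mz _]].
    have [c0|c0] := eqVneq c 0; first by move: Mc; rewrite c0 scale0r subr0.
    apply: no_c; exists c^-1; have := MZ (- c^-1) _ Mc.
    by rewrite scalerBr !scaleNr scalerA mulVf // scale1r opprK addrC.
  exists (c * d + e) => //; have := Mlin c _ _ My Mz.
  by rewrite scalerBr scalerA scalerDl opprD addrACA.
pose xi x : K^o := sval (cid (ex_coord x)).
have xiM x : M (x - xi x *: a) by rewrite /xi; case: cid.
(* Two distinct coordinates would put a nonzero multiple of [a] in [M]. Uniqueness yields both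
   linearity and the value 1 at [a]. *)
have xi_uniq x c : M (x - c *: a) -> xi x = c.
  move=> Mc; apply/eqP; rewrite -subr_eq0; apply: contrapT => /negP d0.
  apply: Ma; have := MZ (xi x - c)^-1 _ (Mlin (-1) _ _ (xiM x) Mc).
  by rewrite scaleN1r opprB addrA subrK -scalerBl scalerA mulVf // scale1r.
have xi_lin : linear xi.
  move=> c x y; apply: xi_uniq; rewrite scalerDl opprD addrACA.
  by rewrite -scalerA -scalerBr; apply: Mlin.
pose xi_linear : {linear V -> K^o} :=
  HB.pack xi (GRing.isLinear.Build K V K^o *:%R xi xi_lin).
exists xi_linear; rewrite /pairing /= (xi_uniq a 1) ?oner_eq0 //.
by rewrite scale1r subrr.
Qed.

(** * Pairings and separating families *)

Section Pairing.
Variables (K : comNzRingType) (V : lmodType K).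

Lemma pairing_eqP (xi eta : dual_space V) :
  (forall x, ⟨xi, x⟩ = ⟨eta, x⟩) -> xi = eta.
Proof. by move=> eq_xi; apply/linear_eqP. Qed.

Lemma pairing0l x : ⟨0 : dual_space V, x⟩ = 0. Proof. by []. Qed.
Lemma pairingDl (xi eta : dual_space V) x :
  ⟨xi + eta, x⟩ = ⟨xi, x⟩ + ⟨eta, x⟩.
Proof. by []. Qed.
Lemma pairingDr (xi : dual_space V) x y : ⟨xi, x + y⟩ = ⟨xi, x⟩ + ⟨xi, y⟩.
Proof. exact: linearD. Qed.
Lemma pairingBr (xi : dual_space V) x y : ⟨xi, x - y⟩ = ⟨xi, x⟩ - ⟨xi, y⟩.
Proof. exact: linearB. Qed.
Lemma pairing0r (xi : dual_space V) : ⟨xi, 0⟩ = 0.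
Proof. exact: linear0. Qed.
Lemma pairingZr (xi : dual_space V) a x : ⟨xi, a *: x⟩ = a * ⟨xi, x⟩.
Proof. exact: (linearZ_LR (xi : {linear V -> K^o})). Qed.
Lemma pairing_sumr (xi : dual_space V) I (r : seq I) (F : I -> V) :
  ⟨xi, \sum_(i <- r) F i⟩ = \sum_(i <- r) ⟨xi, F i⟩.
Proof. exact: (linear_sum (xi : {linear V -> K^o})). Qed.

(** The family is the image of a linear map, so that it can consist of tensors of dual vectors,
    which need not exhaust the dual of a tensor power. *)
Definition separating (X : lmodType K) (phi : {linear X -> dual_space V}) :=
  forall v, (forall x, ⟨phi x, v⟩ = 0) -> v = 0.

End Pairing.

(** * Separation in tensor products *)

Lemma tensor_sum (K : comNzRingType) (U V : lmodType K) (t : U ⊗ V) :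
  exists s : seq (U * V), t = \sum_(p <- s) p.1 ⊗t p.2.
Proof.
elim/tensor_ind: t => [|_ _ [s ->] [r ->]|u v].
- by exists [::]; rewrite big_nil.
- by exists (s ++ r); rewrite big_cat.
- by exists [:: (u, v)]; rewrite big_seq1.
Qed.

Section Separation.
Variables (K : fieldType) (U V X Y : lmodType K).
Variables (phi : {linear X -> dual_space U}) (psi : {linear Y -> dual_space V}).

Lemma tensor_separating : separating phi -> separating psi ->
  separating (dual_tensor U V \o (phi ⊗m psi)).
Proof.
move=> sep_phi sep_psi t; have [s {t}->] := tensor_sum t.
(* The induction is on a length bound: the shorter sum has altered left factors and is not a tail of
   [s]. *)
have [n] := ubnP (size s); elim: n s => // n IHn [|[u v] s] /= lt_s_n ann_s.
  by rewrite big_nil.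
have [u0|/eqP u0] := eqVneq u 0.
  rewrite big_cons u0 linear0l add0r; apply: IHn => // x.
  by have := ann_s x; rewrite big_cons u0 linear0l add0r.
have [x xu0] : exists x, ⟨phi x, u⟩ != 0.
  apply: contrapT => no_x; apply: u0; apply: sep_phi => x.
  by apply/eqP; apply: contrapT => /negP xu; apply: no_x; exists x.
pose c (p : U * V) := ⟨phi x, p.1⟩ / ⟨phi x, u⟩.
(* Contracting the left factors with [phi x] expresses [v] through the other
   right factors, which shortens the sum by one term. *)
have vE : v = - \sum_(p <- s) c p *: p.2.
  apply/eqP; rewrite -addr_eq0; apply/eqP; apply: sep_psi => y.
  have /= := ann_s (x ⊗t y).
  rewrite big_cons tensor_mapE pairingDr dual_tensorE pairing_sumr => ann.
  apply: (mulfI xu0); rewrite mulr0 -[RHS]ann pairingDr mulrDr pairing_sumr.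
  congr (_ + _); rewrite mulr_sumr; apply: eq_bigr => p _.
  by rewrite dual_tensorE pairingZr mulrA [_ * c p]mulrC divfK.
(* Substituting for [v] and collecting by right factors. *)
have sE : \sum_(p <- (u, v) :: s) p.1 ⊗t p.2 =
    \sum_(p <- [seq (p.1 - c p *: u, p.2) | p <- s]) p.1 ⊗t p.2.
  rewrite big_cons big_map /= vE linearNr linear_sumr addrC -sumrB.
  by apply: eq_bigr => p _ /=; rewrite linearBl /= tensZl tensZr.
rewrite sE; apply: IHn; first by rewrite size_map.
by rewrite -sE.
Qed.

End Separation.

(** * Reduction to pure tensors *)

Section TensorPowers.
Variables (K : comNzRingType) (V : lmodType K).

Lemma tensor3_ind (P : V ⊗ V ⊗ V -> Prop) :
    P 0 -> (forall s t, P s -> P t -> P (s + t)) ->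
    (forall a b c, P (a ⊗t b ⊗t c)) ->
  forall t, P t.
Proof.
move=> P0 PD Pt; elim/tensor_ind => // t c.
elim/tensor_ind: t => // [|s t Ps Pt']; first by rewrite linear0l.
by rewrite tensDl; apply: PD.
Qed.

Lemma tensor5_ind (P : V ⊗ V ⊗ V ⊗ V ⊗ V -> Prop) :
    P 0 -> (forall s t, P s -> P t -> P (s + t)) ->
    (forall a b c d e, P (a ⊗t b ⊗t c ⊗t d ⊗t e)) ->
  forall t, P t.
Proof.
move=> P0 PD Pt; elim/tensor_ind => // t e.
elim/tensor_ind: t => [|s t Ps Pt'|t d].
- by rewrite linear0l.
- by rewrite tensDl; apply: PD.
elim/tensor3_ind: t => // [|s t Ps Pt']; first by rewrite !linear0l.
by rewrite !tensDl; apply: PD.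
Qed.

End TensorPowers.

Section TernaryOperationsE.
Variables (K : comNzRingType) (V : lmodType K).
Variables (mu : {linear V ⊗ V ⊗ V -> V}) (Delta : {linear V -> V ⊗ V ⊗ V}).

Lemma mu_id_idE a b c d e :
  mu_id_id mu (a ⊗t b ⊗t c ⊗t d ⊗t e) = mu (a ⊗t b ⊗t c) ⊗t d ⊗t e.
Proof. by rewrite /mu_id_id !tensor_mapE. Qed.

Lemma id_mu_idE a b c d e :
  id_mu_id mu (a ⊗t b ⊗t c ⊗t d ⊗t e) = a ⊗t mu (b ⊗t c ⊗t d) ⊗t e.
Proof.
rewrite -[LHS]/((idfun ⊗m mu ⊗m idfun) (split131 V _)) split131E.
by rewrite !tensor_mapE.
Qed.

Lemma id_id_muE a b c d e :
  id_id_mu mu (a ⊗t b ⊗t c ⊗t d ⊗t e) = a ⊗t b ⊗t mu (c ⊗t d ⊗t e).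
Proof.
rewrite -[LHS]/((idfun ⊗m idfun ⊗m mu) (split113 V _)) split113E.
by rewrite !tensor_mapE.
Qed.

Lemma Delta_id_idE x y z :
  Delta_id_id Delta (x ⊗t y ⊗t z) = Delta x ⊗t y ⊗t z.
Proof. by rewrite /Delta_id_id !tensor_mapE. Qed.

Lemma id_Delta_idE x y z :
  id_Delta_id Delta (x ⊗t y ⊗t z) = join131 V (x ⊗t Delta y ⊗t z).
Proof.
by rewrite -[LHS]/(join131 V ((idfun ⊗m Delta ⊗m idfun) _)) !tensor_mapE.
Qed.

Lemma id_id_DeltaE x y z :
  id_id_Delta Delta (x ⊗t y ⊗t z) = join113 V (x ⊗t y ⊗t Delta z).
Proof.
by rewrite -[LHS]/(join113 V ((idfun ⊗m idfun ⊗m Delta) _)) !tensor_mapE.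
Qed.

End TernaryOperationsE.

(** * Transposing the composites of [Delta] *)

Section DualOperations.
Variables (K : comNzRingType) (A : lmodType K).

Local Notation A' := (dual_space A).

Definition dual_tensor5 :
    {linear A' ⊗ A' ⊗ A' ⊗ A' ⊗ A' -> dual_space (A ⊗ A ⊗ A ⊗ A ⊗ A)} :=
  dual_tensor _ A \o ((dual_tensor _ A \o (dual_tensor3 A ⊗m idfun)) ⊗m idfun).

Lemma dual_tensor5E a b c d e t y z :
  ⟨dual_tensor5 (a ⊗t b ⊗t c ⊗t d ⊗t e), t ⊗t y ⊗t z⟩
    = ⟨dual_tensor3 A (a ⊗t b ⊗t c), t⟩ * ⟨d, y⟩ * ⟨e, z⟩.
Proof. by rewrite /= tensor_mapE dual_tensorE /= tensor_mapE dual_tensorE. Qed.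

(** By additivity in [t], pure [t] suffice, where both sides are the same product of five
    scalars. *)
Lemma dual_tensor5_join131 a b c d e x t z :
  ⟨dual_tensor5 (a ⊗t b ⊗t c ⊗t d ⊗t e), join131 A (x ⊗t t ⊗t z)⟩
    = ⟨a, x⟩ * ⟨dual_tensor3 A (b ⊗t c ⊗t d), t⟩ * ⟨e, z⟩.
Proof.
elim/tensor3_ind: t => [|s t Es Et|u v w].
- by rewrite linear0r linear0l linear0 !pairing0r mulr0 mul0r.
- by rewrite tensDr tensDl linearD !pairingDr mulrDr mulrDl Es Et.
by rewrite join131E dual_tensor5E !dual_tensor3E -!mulrA.
Qed.

Lemma dual_tensor5_join113 a b c d e x y t :
  ⟨dual_tensor5 (a ⊗t b ⊗t c ⊗t d ⊗t e), join113 A (x ⊗t y ⊗t t)⟩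
    = ⟨a, x⟩ * ⟨b, y⟩ * ⟨dual_tensor3 A (c ⊗t d ⊗t e), t⟩.
Proof.
elim/tensor3_ind: t => [|s t Es Et|u v w].
- by rewrite linear0r linear0 !pairing0r mulr0.
- by rewrite tensDr linearD !pairingDr mulrDr Es Et.
by rewrite join113E dual_tensor5E !dual_tensor3E !mulrA.
Qed.

Variable Delta : {linear A -> A ⊗ A ⊗ A}.

Lemma dual_mu_id_id t z :
  ⟨dual_tensor3 A (mu_id_id (dual_map Delta) t), z⟩
    = ⟨dual_tensor5 t, Delta_id_id Delta z⟩.
Proof.
elim/tensor5_ind: t => [|s t Es Et|a b c d e].
- by rewrite !linear0 !pairing0l.
- by rewrite !linearD !pairingDl Es Et.
elim/tensor3_ind: z => [|s t Es Et|x y w].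
- by rewrite linear0 !pairing0r.
- by rewrite linearD !pairingDr Es Et.
(* What remains holds by definition: [dual_map Delta] evaluated at [x] is the pairing with
   [Delta x]. *)
by rewrite mu_id_idE Delta_id_idE dual_tensor5E dual_tensor3E.
Qed.

Lemma dual_id_mu_id t z :
  ⟨dual_tensor3 A (id_mu_id (dual_map Delta) t), z⟩
    = ⟨dual_tensor5 t, id_Delta_id Delta z⟩.
Proof.
elim/tensor5_ind: t => [|s t Es Et|a b c d e].
- by rewrite !linear0 !pairing0l.
- by rewrite !linearD !pairingDl Es Et.
elim/tensor3_ind: z => [|s t Es Et|x y w].
- by rewrite linear0 !pairing0r.
- by rewrite linearD !pairingDr Es Et.
by rewrite id_mu_idE id_Delta_idE dual_tensor5_join131 dual_tensor3E.
Qed.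

Lemma dual_id_id_mu t z :
  ⟨dual_tensor3 A (id_id_mu (dual_map Delta) t), z⟩
    = ⟨dual_tensor5 t, id_id_Delta Delta z⟩.
Proof.
elim/tensor5_ind: t => [|s t Es Et|a b c d e].
- by rewrite !linear0 !pairing0l.
- by rewrite !linearD !pairingDl Es Et.
elim/tensor3_ind: z => [|s t Es Et|x y w].
- by rewrite linear0 !pairing0r.
- by rewrite linearD !pairingDr Es Et.
by rewrite id_id_muE id_id_DeltaE dual_tensor5_join113 dual_tensor3E.
Qed.

End DualOperations.

(** * Equivalence of the identities *)

Lemma dual_tensor5_separating (K : fieldType) (A : lmodType K) :
  separating (dual_tensor5 A).
Proof.
have sep1 : @separating K A _ idfun.
  move=> v ann_v; have [//|/eqP/dual_space_separates[xi]] := pselect (v = 0).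
  by rewrite ann_v eqxx.
have sep2 : separating (dual_tensor A A).
  by move=> t ann_t; apply: (tensor_separating sep1 sep1) => x; apply: ann_t.
(* The fifth, fourth and third factors are peeled off in turn, down to [sep2]. *)
by do 3![apply: tensor_separating => //].
Qed.

(* [F] and [G] are meant to be among the maps [Delta_id_id Delta], ... and their
   sums, [mu_F] and [mu_G] the corresponding maps for [dual_map Delta]. *)
Lemma dual_map_eq (K : fieldType) (A : lmodType K)
    (Delta : {linear A -> A ⊗ A ⊗ A}) (F G : A ⊗ A ⊗ A -> A ⊗ A ⊗ A ⊗ A ⊗ A)
    mu_F mu_G :
    (forall t z, ⟨dual_tensor3 A (mu_F t), z⟩ = ⟨dual_tensor5 A t, F z⟩) ->
    (forall t z, ⟨dual_tensor3 A (mu_G t), z⟩ = ⟨dual_tensor5 A t, G z⟩) ->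
  F \o Delta =1 G \o Delta <->
    dual_map Delta \o mu_F =1 dual_map Delta \o mu_G.
Proof.
move=> FE GE; split=> [FG t|mu_FG x].
  apply: pairing_eqP => x.
  rewrite -[LHS]/⟨dual_tensor3 A (mu_F t), Delta x⟩ FE [F _]FG /=.
  by rewrite -GE.
(* Every [dual_tensor5 A t] kills the difference of the two sides. *)
apply/eqP; rewrite -subr_eq0; apply/eqP.
apply: dual_tensor5_separating => t; rewrite pairingBr -FE -GE.
rewrite -[X in X - _]/⟨(dual_map Delta \o mu_F) t, x⟩ mu_FG.
by rewrite -[X in X - _]/⟨dual_tensor3 A (mu_G t), Delta x⟩ subrr.
Qed.

Theorem theorem2p9 (K : fieldType) (charK : [pchar K] =i pred0)
    (A : lmodType K) (Delta : {linear A -> A ⊗ A ⊗ A}) :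
  [/\ partially_coassociative Delta <->
        partially_associative (dual_map Delta),
      totally_coassociative Delta <->
        totally_associative (dual_map Delta)
    & weak_totally_coassociative Delta <->
        weak_totally_associative (dual_map Delta)].
Proof.
have E12 := dual_map_eq Delta (dual_mu_id_id Delta) (dual_id_mu_id Delta).
have E23 := dual_map_eq Delta (dual_id_mu_id Delta) (dual_id_id_mu Delta).
have E13 := dual_map_eq Delta (dual_mu_id_id Delta) (dual_id_id_mu Delta).
split=> //; last by rewrite /totally_coassociative E12 E23.
have sumE t z : ⟨dual_tensor3 A ((mu_id_id (dual_map Delta) \+
      id_mu_id (dual_map Delta) \+ id_id_mu (dual_map Delta)) t), z⟩ =
    ⟨dual_tensor5 A t,
      (Delta_id_id Delta \+ id_Delta_id Delta \+ id_id_Delta Delta) z⟩.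
  rewrite 2!linearD !pairingDl dual_mu_id_id dual_id_mu_id dual_id_id_mu.
  by rewrite -!pairingDr.
(* The partial identity compares the sum of the three maps with zero, so [\0] serves as [G] and
   [mu_G]. *)
have zeroE (t : dual_space A ⊗ dual_space A ⊗ dual_space A ⊗ dual_space A
    ⊗ dual_space A) (z : A ⊗ A ⊗ A) :
    ⟨dual_tensor3 A (\0 t), z⟩ = ⟨dual_tensor5 A t, \0 z⟩.
  by rewrite linear0 pairing0r.
apply: iff_trans (dual_map_eq Delta sumE zeroE) _.
(* [dual_map Delta \o \0] must still be identified with [\0]. *)
by split=> E0 t; rewrite [LHS]E0 /= linear0.
Qed.
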